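(* The Shift-Sort-and-Match procedure described below is well defined (in particular it never pops from an empty stack), and the set of arcs it outputs is an optimal solution to the Periodic Assignment Problem; it runs in $\mathcal{O}(n\log n)$ time. Shift-Sort-and-Match: choose $t^*\in[0,T)$ with $\mathcal{I}(t^* )=L$ and replace every $a_i,b_i$ by $[a_i-t^*]_T,[b_i-t^*]_T$ (so that afterwards $\mathcal{I}(0)=L$). Form the list $R$ of the $2n$ time points $a_i$ (tagged ''start of task $i$'') and $b_i$ (tagged ''end of task $i$''), sorted in increasing order of value, with ties broken by placing ends before starts. Initialize an empty last-in-first-out stack $Q$ and an empty set $\mathcal{M}$, and set $p=1$. While $p\le|R|$: if $R[p]$ is a start, pop the top element $e$ of $Q$ and match $e$ to $R[p]$, and set $p\leftarrow p+1$; else, if $R[p+1]$ is a start, match $R[p]$ to $R[p+1]$ and set $p\leftarrow p+2$; else push $R[p]$ onto $Q$ and set $p\leftarrow p+1$. Each matched pair (end of task $k$, start of task $l$) gives the arc $(k,l)$ of the output $\mathcal{M}$.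
   Context: Let $T$ be a positive integer (the period) and let $\mathcal{I}$ be a finite set of $n\ge 1$ tasks. For $x\in\mathbb{R}$, $[x]_T$ denotes the unique element of $[0,T)$ congruent to $x$ modulo $T$. Each task $i$ is given by $a_i,b_i\in[0,T)$ and occupies the $T$-periodic open interval $(a_i,b_i):=\{t\in[0,T):0<[t-a_i]_T<c(i)\}$, where $c(i):=[b_i-a_i]_T$ is its duration. For $t\in[0,T)$, $\mathcal{I}(t)$ is the number of tasks whose interval contains $t$, and the load is $L:=\max_{t\in[0,T)}\mathcal{I}(t)$. For every ordered pair $(i,j)$ of tasks (including $i=j$) the transition time is $c_{ij}:=[a_j-b_i]_T$. A periodic assignment is a set $\mathcal{M}\subseteq\mathcal{I}\times\mathcal{I}$ such that every task has exactly one arc of $\mathcal{M}$ leaving it and exactly one entering it. The Periodic Assignment Problem (PAP) asks for a periodic assignment minimizing $\sum_{(i,j)\in\mathcal{M}}c_{ij}$. *)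

(* Defs.v *)
From mathcomp Require Import all_boot all_order all_algebra.
From mathcomp Require Import boolp reals exp.

Set Implicit Arguments.
Unset Strict Implicit.
Unset Printing Implicit Defensive.

Import Order.TTheory GRing.Theory Num.Theory.
Local Open Scope ring_scope.

Section PeriodicAssignment.
Context {R : realType} {I : finType}.
Implicit Types (T : nat) (a b : I -> R) (t x : R) (M : {set I * I}).

Definition pmod T x : R := x - T%:R * (Num.floor (x / T%:R))%:~R.

Definition pap_instance T a b : Prop :=
  [/\ (0 < T)%N, (0 < #|I|)%N
    & forall i, 0 <= a i < T%:R /\ 0 <= b i < T%:R].

Definition duration T a b (i : I) : R := pmod T (b i - a i).

Definition tasks_at T a b t : nat :=
  #|[set i | 0 < pmod T (t - a i) < duration T a b i]|.

(* tasks_at never exceeds #|I|, so the maximum over t is the maximum of the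
   finite set of attained values. *)
Definition load T a b : nat :=
  \max_(k < #|I|.+1
       | `[< exists t, 0 <= t < T%:R /\ tasks_at T a b t = k >]) k.

Definition transition_time T a b (i j : I) : R := pmod T (a j - b i).

Definition periodic_assignment M : Prop :=
  (forall i, exists! j, (i, j) \in M) /\ (forall j, exists! i, (i, j) \in M).

Definition total_time T a b M : R :=
  \sum_(ij in M) transition_time T a b ij.1 ij.2.

Definition pap_optimal T a b M : Prop :=
  periodic_assignment M /\
  forall M', periodic_assignment M' -> total_time T a b M <= total_time T a b M'.

Definition peak T a b t : Prop :=
  0 <= t < T%:R /\ tasks_at T a b t = load T a b.

Definition shift T t (f : I -> R) : I -> R := fun i => pmod T (f i - t).

End PeriodicAssignment.

(* A time point with its tag: inl k marks the end of task k, inr l the start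
   of task l. *)
Definition event (R I : Type) : Type := (R * (I + I))%type.

Definition is_end {R I : Type} (e : event R I) : bool :=
  if e.2 is inl _ then true else false.

Section Procedure.
Context {R : realType} {I : finType}.
Implicit Types (T : nat) (a b : I -> R) (M : {set I * I}).

Definition events a b : seq (R * (I + I)) :=
  [seq (b k, inl k) | k <- enum I] ++ [seq (a l, inr l) | l <- enum I].

Definition event_le (e f : event R I) : bool :=
  (e.1 < f.1) || (e.1 == f.1) && (is_end e || ~~ is_end f).

(* The order of two starts, or of two ends, at the same time is left free. *)
Definition sorted_events a b (s : seq (R * (I + I))) : Prop :=
  perm_eq s (events a b) /\ sorted event_le s.

(* s is the part of the list from the current position on, Q the stack with its
   top in front. The result is None when the procedure pops from the empty
   stack, or when it looks for a successor of the last entry of the list. *)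
Fixpoint match_events (Q : seq I) M (s : seq (event R I)) :
    option {set I * I} :=
  match s with
  | [::] => Some M
  | (_, inr l) :: s1 =>
      if Q is k :: Q' then match_events Q' ((k, l) |: M) s1 else None
  | (_, inl k) :: s1 =>
      match s1 with
      | [::] => None
      | (_, inr l) :: s2 => match_events Q ((k, l) |: M) s2
      | (_, inl _) :: _ => match_events (k :: Q) M s1
      end
  end.

Definition ssm_outcome T a b M : Prop :=
  exists t s, [/\ peak T a b t,
    sorted_events (shift T t a) (shift T t b) s
    & match_events [::] finset.set0 s = Some M].

End Procedure.

(* Running time is measured on a real RAM: a computation carries its result and
   the number of units it used. Each function call is charged one unit, which
   pays for the bounded number of case distinctions and list constructions in
   its body; each arithmetic operation and each comparison, on reals or on the
   counters, is charged one more unit. Reading a i or b i is part of the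
   operation using it. No recursion is performed outside of charged calls. *)
Definition timed (A : Type) : Type := (A * nat)%type.

Definition value {A : Type} (m : timed A) : A := m.1.
Definition time {A : Type} (m : timed A) : nat := m.2.

Definition ret {A : Type} (x : A) : timed A := (x, 0%N).
Definition op {A : Type} (x : A) : timed A := (x, 1%N).
Definition call {A : Type} (m : timed A) : timed A := (m.1, m.2.+1).
Definition bind {A B : Type} (m : timed A) (f : A -> timed B) : timed B :=
  let r := f m.1 in (r.1, (m.2 + r.2)%N).

Notation "'let*' x ':=' m 'in' f" := (bind m (fun x => f))
  (at level 200, x name, m at level 200, f at level 200).

Section Program.
Context {R : realFieldType} {I : Type}.
Implicit Types (T t x y : R) (a b : I -> R) (tasks Q : seq I).
Implicit Types (e : event R I) (s : seq (event R I)) (arcs : seq (I * I)).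

(* The difference modulo T of two points of [0, T), without a floor. *)
Definition prog_sub T x y : timed R :=
  call (let* d := op (x - y) in
        let* neg := op (d < 0) in
        if neg then op (d + T) else ret d).

Definition prog_le e1 e2 : timed bool :=
  call (let* lt := op (e1.1 < e2.1) in
        if lt then ret true else
        let* eq := op (e1.1 == e2.1) in
        ret (eq && (is_end e1 || ~~ is_end e2))).

(* Merge sort with the recursion scheme of path.sort_rec1: the entry of rank i
   of ss is empty or a sorted list of length 2 ^ i. *)
Fixpoint prog_merge s1 : seq (event R I) -> timed (seq (event R I)) :=
  match s1 with
  | [::] => fun s2 => call (ret s2)
  | e1 :: s1' =>
      fix merge_s1 s2 : timed (seq (event R I)) :=
        call match s2 with
        | [::] => ret s1
        | e2 :: s2' =>
            let* le := prog_le e1 e2 in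
            if le then let* r := prog_merge s1' s2 in ret (e1 :: r)
            else let* r := merge_s1 s2' in ret (e2 :: r)
        end
  end.

Fixpoint prog_sort_push s1 (ss : seq (seq (event R I))) :
    timed (seq (seq (event R I))) :=
  call match ss with
  | [::] => ret [:: s1]
  | [::] :: ss' => ret (s1 :: ss')
  | s2 :: ss' =>
      let* s3 := prog_merge s2 s1 in
      let* r := prog_sort_push s3 ss' in
      ret ([::] :: r)
  end.

Fixpoint prog_sort_pop s1 (ss : seq (seq (event R I))) :
    timed (seq (event R I)) :=
  call match ss with
  | [::] => ret s1
  | s2 :: ss' => let* s3 := prog_merge s2 s1 in prog_sort_pop s3 ss'
  end.

Fixpoint prog_sort (ss : seq (seq (event R I))) s : timed (seq (event R I)) :=
  call match s with
  | [::] => prog_sort_pop [::] ss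
  | e :: s' => let* ss' := prog_sort_push [:: e] ss in prog_sort ss' s'
  end.

Fixpoint prog_events T t a b tasks : timed (seq (event R I)) :=
  call match tasks with
  | [::] => ret [::]
  | i :: tasks' =>
      let* ai := prog_sub T (a i) t in
      let* bi := prog_sub T (b i) t in
      let* s := prog_events T t a b tasks' in
      ret ((bi, inl i) :: (ai, inr i) :: s)
  end.

(* The number of tasks in progress just before time 0 (modulo the period). *)
Fixpoint prog_wrapping a b tasks : timed int :=
  call match tasks with
  | [::] => ret 0
  | i :: tasks' =>
      let* k := prog_wrapping a b tasks' in
      let* wraps := op (b i < a i) in
      if wraps then op (k + 1) else ret k
  end.

(* Sweep over the sorted events. k counts the tasks in progress (an int, since a
   task of duration 0 ends before it starts), kmax is the largest count seen
   after a start, tmax the middle of the gap that follows this start. The count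
   is maximal inside a gap, not at an event, as the intervals are open. *)
Fixpoint prog_sweep T s (k kmax : int) tmax : timed R :=
  call match s with
  | [::] => ret tmax
  | (_, inl _) :: s' => let* k' := op (k - 1) in prog_sweep T s' k' kmax tmax
  | (x, inr _) :: s' =>
      let* k' := op (k + 1) in
      let* better := op (kmax < k') in
      if better then
        let next := if s' is (y, _) :: _ then y else T in
        let* d := op (x + next) in
        let* mid := op (d / 2) in
        prog_sweep T s' k' k' mid
      else prog_sweep T s' k' kmax tmax
  end.

Fixpoint prog_match Q arcs s : timed (option (seq (I * I))) :=
  call match s with
  | [::] => ret (Some arcs)
  | (_, inr l) :: s1 =>
      if Q is k :: Q' then prog_match Q' ((k, l) :: arcs) s1 else ret None
  | (_, inl k) :: s1 =>
      match s1 with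
      | [::] => ret None
      | (_, inr l) :: s2 => prog_match Q ((k, l) :: arcs) s2
      | (_, inl _) :: _ => prog_match (k :: Q) arcs s1
      end
  end.

Definition ssm_program T a b tasks : timed (option (seq (I * I))) :=
  call (let* s0 := prog_events T 0 a b tasks in
        let* s := prog_sort [::] s0 in
        let* k := prog_wrapping a b tasks in
        let* t := prog_sweep T s k 0 0 in
        let* r0 := prog_events T t a b tasks in
        let* r := prog_sort [::] r0 in
        prog_match [::] [::] r).

End Program.

(* Main.v *)
(* Cut the period at a peak t* and write a', b' for the shifted times. No load
   exceeds the one at the cut, so that every prefix of the sorted list up to and
   including a start holds at least as many ends as starts. Hence every start
   finds an end on the stack, and each end k is matched to a start l with
   b'_k <= a'_l, at cost a'_l - b'_k. The total is \sum a' - \sum b', a lower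
   bound for every assignment since the residue of x is at least x for
   -T < x < T.

   The sweep finds a peak because the number of tasks in progress is largest in
   a gap that follows a start. The 2n events cost O(n log n) to sort: each of
   them takes part in at most one merge per level, and there are O(log n)
   levels. *)
Require Import Defs.
From mathcomp Require Import all_boot all_order all_algebra.
From mathcomp Require Import boolp reals exp.
From mathcomp Require Import zify ring lra.

Import Order.TTheory GRing.Theory Num.Theory.
Local Open Scope ring_scope.

Set Implicit Arguments.
Unset Strict Implicit.
Unset Printing Implicit Defensive.

(** * Residues and loads *)

Section Modulo.
Variables (R : realType) (T : nat).
Hypothesis T_gt0 : (0 < T)%N.
Implicit Types (x y : R) (m : int).

Let T_pos : 0 < T%:R :> R. Proof. by rewrite ltr0n. Qed.

Lemma pmod_range x : 0 <= pmod T x < T%:R.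
Proof.
have := floor_itv (x / T%:R); rewrite ler_pdivlMr // ltr_pdivrMr // intrD.
by rewrite /pmod; lra.
Qed.

Lemma pmodDM x m : pmod T (x + T%:R * m%:~R) = pmod T x.
Proof.
have T0 : T%:R != 0 :> R by rewrite gt_eqF.
rewrite /pmod mulrDl [_ * m%:~R]mulrC mulfK // floorDrz ?intr_int //.
by rewrite intrKfloor intrD; ring.
Qed.

Lemma pmod_congr x : exists m, pmod T x = x + T%:R * m%:~R.
Proof. by exists (- Num.floor (x / T%:R)); rewrite /pmod intrN mulrN. Qed.

Lemma pmod_id x : 0 <= x < T%:R -> pmod T x = x.
Proof.
move=> x_range; rewrite /pmod (_ : Num.floor _ = 0) ?mulr0 ?subr0 //.
by apply: floor_def; rewrite ler_pdivlMr // ltr_pdivrMr //; lra.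
Qed.

Lemma pmod_sub x y : 0 <= x < T%:R -> 0 <= y < T%:R ->
  pmod T (x - y) = if x < y then x - y + T%:R else x - y.
Proof.
move=> xr yr; case: ltP => xy; last by apply: pmod_id; lra.
by rewrite -(pmodDM _ 1) mulr1z mulr1; apply: pmod_id; lra.
Qed.

Lemma pmod_sub_ge x y : 0 <= x < T%:R -> 0 <= y < T%:R ->
  x - y <= pmod T (x - y).
Proof. by move=> xr yr; rewrite pmod_sub //; case: ifP => _; lra. Qed.

Lemma pmodB x y : pmod T (pmod T x - pmod T y) = pmod T (x - y).
Proof.
have [[m ->] [n ->]] := (pmod_congr x, pmod_congr y).
by rewrite -(pmodDM (x - y) (m - n)) intrB; congr pmod; ring.
Qed.

Lemma pmodBl x y : pmod T (pmod T x - y) = pmod T (x - y).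
Proof.
have [m ->] := pmod_congr x.
by rewrite -(pmodDM (x - y) m); congr pmod; ring.
Qed.

End Modulo.

Section Load.
Variables (R : realType) (I : finType) (T : nat).
Hypothesis T_gt0 : (0 < T)%N.
Implicit Types (a b : I -> R) (t x : R).

Lemma transition_time_shift t a b i j :
  transition_time T (shift T t a) (shift T t b) i j = transition_time T a b i j.
Proof. by rewrite /transition_time pmodB //; congr pmod; ring. Qed.

(** A shift rotates the circle of times: durations are kept, and the offset of [x] from a shifted
    start is that of [x + t] from the original one. *)
Lemma tasks_at_shift t a b x :
  tasks_at T (shift T t a) (shift T t b) x = tasks_at T a b (pmod T (x + t)).
Proof.
have start i : pmod T (x - shift T t a i) = pmod T (pmod T (x + t) - a i).
  rewrite pmodBl // /shift; have [m ->] := pmod_congr T (a i - t).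
  by rewrite -(pmodDM T_gt0 (x + t - a i) (- m)) intrN; congr pmod; ring.
have length i : duration T (shift T t a) (shift T t b) i = duration T a b i.
  by rewrite /duration pmodB //; congr pmod; ring.
by rewrite /tasks_at; apply: eq_card => i; rewrite !inE start length.
Qed.

Lemma tasks_at_le_load a b t : 0 <= t < T%:R -> (tasks_at T a b t <= load T a b)%N.
Proof.
move=> tr; have le : (tasks_at T a b t < #|I|.+1)%N by rewrite ltnS max_card.
rewrite /load; apply: (leq_bigmax_cond (Ordinal le)).
by apply/asboolP; exists t.
Qed.

(** The attained loads form a finite set that contains the load at 0, so the maximum is attained. *)
Lemma exists_peak a b : exists t, peak T a b t.
Proof.
have T0 : 0 <= (0 : R) < T%:R by rewrite lexx ltr0n.
pose P (k : 'I_#|I|.+1) := `[< exists t, 0 <= t < T%:R /\ tasks_at T a b t = k >].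
have le : (tasks_at T a b 0 < #|I|.+1)%N by rewrite ltnS max_card.
have P0 : P (Ordinal le) by apply/asboolP; exists 0.
have /asboolP[t [tr tE]] : P [arg max_(k > Ordinal le | P k) k].
  by case: arg_maxnP.
by exists t; split => //; rewrite tE /load (bigop.bigmax_eq_arg _ P0).
Qed.

(** * Loads expressed by counting starts and ends *)

Section Sweep.
Variables (a b : I -> R).
Hypotheses (a_range : forall i, 0 <= a i < T%:R).
Hypotheses (b_range : forall i, 0 <= b i < T%:R).

Lemma in_progressE t i : 0 <= t < T%:R ->
  (0 < pmod T (t - a i) < duration T a b i) =
  (if b i < a i then (t < b i) || (a i < t) else a i < t < b i).
Proof.
move=> tr; have [ar br] := (a_range i, b_range i).
rewrite /duration !pmod_sub //.
by case: (ltP (b i)) => ba; case: (ltP t (a i)) => ta;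
  apply/idP/idP; case: (ltP (a i) t) => ?; case: (ltP t (b i)) => ? //=; lra.
Qed.

Lemma tasks_atE t : tasks_at T a b t =
  (\sum_i (0 < pmod T (t - a i) < duration T a b i)%R)%N.
Proof. by rewrite /tasks_at -sum1_card big_mkcond; apply: eq_bigr => i; rewrite inE. Qed.

(** Holds task by task: wrapping tasks are in progress just before 0, a start adds one task and an
    end removes one. It is strict only when a task of positive duration starts exactly at [t], its
    interval being open. Ends stand on the left to avoid subtraction in [nat]. *)
Lemma tasks_at_le t : 0 <= t < T%:R ->
  (tasks_at T a b t + \sum_i (b i <= t)%R <=
   \sum_i (b i < a i)%R + \sum_i (a i <= t)%R)%N.
Proof.
move=> tr; rewrite tasks_atE -!big_split /=; apply: leq_sum => i _.
rewrite in_progressE //.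
by case: (ltP (b i)) => ?; case: (ltP (a i) t) => ?; case: (ltP t (b i)) => ?;
  case: (leP (a i) t) => ? //=; exfalso; lra.
Qed.

Lemma tasks_at_gap t : 0 <= t < T%:R -> (forall i, a i != t /\ b i != t) ->
  (tasks_at T a b t + \sum_i (b i <= t)%R =
   \sum_i (b i < a i)%R + \sum_i (a i <= t)%R)%N.
Proof.
move=> tr gap; rewrite tasks_atE -!big_split /=; apply: eq_bigr => i _.
rewrite in_progressE //; have [] := gap i.
by case: (ltgtP (a i) t) => // ? _; case: (ltgtP (b i) t) => // ? _;
  case: (ltP (b i)) => ? //=; exfalso; lra.
Qed.

(** A start is never negative, so only a wrapping task can contain 0. A wrapping task that ends at 0
    does not contain it, whence only an inequality. *)
Lemma tasks_at0_le : (tasks_at T a b 0 <= \sum_i (b i < a i)%R)%N.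
Proof.
rewrite tasks_atE; apply: leq_sum => i _.
rewrite in_progressE; last by rewrite lexx ltr0n.
by have := a_range i; case: ifP => [_ | _ /andP[a0 _]]; [case: (_ || _) | rewrite ltNge a0].
Qed.

End Sweep.

(** Replaces an event time by a time just after it, where the exact load formula applies. The
    induction lowers [t] below each new element that exceeds [x]. *)
Lemma gap_after (r : seq R) x y : x < y ->
  exists2 t, x < t < y & all (fun z => (z <= t) == (z <= x)) r.
Proof.
elim: r => [|z r IHr] xy; first by exists ((x + y) / 2) => //; lra.
have [t tr /allP rt] := IHr xy.
case: (leP z x) => zx.
  exists t => //=; rewrite (introT allP rt) andbT (_ : z <= t = true) ?zx //.
  by apply/idP; lra.
(* This midpoint is below both [z] and the old [t], so the elements already handled keep their
   side. *)
pose t' := (x + Num.min z t) / 2.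
have t'x : x < t' by rewrite /t' /Num.min; case: (ltP z t) => ?; lra.
have t't : t' < t by rewrite /t' /Num.min; case: (ltP z t) => ?; lra.
have t'z : t' < z by rewrite /t' /Num.min; case: (ltP z t) => ?; lra.
exists t'; first by lra.
rewrite /= leNgt t'z leNgt zx /=; apply/allP => w wr.
have /eqP wt := rt w wr; apply/eqP; case: (leP w x) wt => wx wt.
  by apply/idP; lra.
by apply/negbTE; move/negbT: wt; rewrite -!ltNge; lra.
Qed.

End Load.

(** * Sorted events and their matching *)

Section Events.
Context {R : realType} {I : finType}.
Implicit Types (a b : I -> R) (x : R) (e f : event R I) (s p q : seq (event R I)).

Definition is_start e := ~~ is_end e.
Definition end_task e := if e.2 is inl k then Some k else None.
Definition start_task e := if e.2 is inr l then Some l else None.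

Lemma event_le_time e f : event_le e f -> e.1 <= f.1.
Proof. by case/orP => [/ltW|/andP[/eqP->]]. Qed.

Lemma event_le_trans : transitive (@event_le R I).
Proof.
move=> f e g; rewrite /event_le.
case: (ltgtP e.1 f.1) => //= ef; case: (ltgtP f.1 g.1) => //= fg.
- by rewrite (lt_trans ef fg).
- by rewrite -fg ef.
- by rewrite ef fg.
- by rewrite ef fg ltxx eqxx /=; case: (is_end e); case: (is_end f).
Qed.

Lemma event_le_total : total (@event_le R I).
Proof.
move=> e f; rewrite /event_le; case: ltgtP => //= _.
by case: (is_end e); case: (is_end f).
Qed.

Lemma sorted_cut s x : sorted event_le s ->
  exists p q, [/\ s = p ++ q, all (fun e => e.1 <= x) p & all (fun e => x < e.1) q].
Proof.
elim: s => [|e s IHs] /= es; first by exists [::], [::].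
have [p [q [sE px qx]]] := IHs (path_sorted es).
case: (leP e.1 x) => ex; first by exists (e :: p), q; rewrite sE /= ex.
exists [::], (e :: s); split => //=; rewrite ex /=.
have /(_ event_le_trans)/= := order_path_min _ es.
by apply: sub_all => f /event_le_time; apply: lt_le_trans.
Qed.

Lemma count_ends a b (P : pred R) s : perm_eq s (events a b) ->
  count (fun e => is_end e && P e.1) s = (\sum_i P (b i))%N.
Proof.
move/permP->; rewrite count_cat.
rewrite [X in (_ + X)%N](_ : _ = 0%N) ?addn0; last by elim: (enum I).
by rewrite count_map -sum1_count big_mkcond big_enum.
Qed.

Lemma count_starts a b (P : pred R) s : perm_eq s (events a b) ->
  count (fun e => is_start e && P e.1) s = (\sum_i P (a i))%N.
Proof.
move/permP->; rewrite count_cat.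
rewrite [X in (X + _)%N](_ : _ = 0%N) ?add0n; last by elim: (enum I).
by rewrite count_map -sum1_count big_mkcond big_enum.
Qed.

Lemma perm_ends a b s : perm_eq s (events a b) -> perm_eq (pmap end_task s) (enum I).
Proof.
move/(perm_pmap end_task)/perm_trans; apply; rewrite pmap_cat.
have -> (r : seq I) : pmap end_task [seq (b k, inl k) | k <- r] = r.
  by elim: r => //= k r ->.
have -> (r : seq I) : pmap end_task [seq (a k, inr k) | k <- r] = [::].
  by elim: r.
by rewrite cats0.
Qed.

Lemma perm_starts a b s :
  perm_eq s (events a b) -> perm_eq (pmap start_task s) (enum I).
Proof.
move/(perm_pmap start_task)/perm_trans; apply; rewrite pmap_cat.
have -> (r : seq I) : pmap start_task [seq (b k, inl k) | k <- r] = [::].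
  by elim: r.
have -> (r : seq I) : pmap start_task [seq (a k, inr k) | k <- r] = r.
  by elim: r => //= k r ->.
by [].
Qed.

Lemma mem_events a b s e : perm_eq s (events a b) -> e \in s ->
  e.1 = match e.2 with inl k => b k | inr l => a l end.
Proof. by move/perm_mem->; rewrite mem_cat => /orP[] /mapP[k _ ->]. Qed.

Lemma count_is_end a b s : perm_eq s (events a b) -> count is_end s = #|I|.
Proof.
move/count_ends => /(_ predT); rewrite sum1_card => <-.
by apply: eq_count => e; rewrite andbT.
Qed.

Lemma count_is_start a b s : perm_eq s (events a b) -> count is_start s = #|I|.
Proof.
move/count_starts => /(_ predT); rewrite sum1_card => <-.
by apply: eq_count => e; rewrite andbT.
Qed.

(* At equal times the ends come first, so that all ends at time x are in p. *)
Lemma sorted_at_start p x l q : sorted event_le (p ++ (x, inr l) :: q) ->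
  all (fun e => e.1 <= x) p /\
  all (fun e => (x < e.1) || is_start e && (e.1 == x)) q.
Proof.
rewrite sorted_pairwise; last exact: event_le_trans.
rewrite pairwise_cat /= => /and3P[/allrelP pq _ /andP[xq _]]; split.
  apply/allP => e ep; have /event_le_time := pq _ (x, inr l) ep (mem_head _ _).
  by [].
by apply: sub_all xq => e; rewrite /event_le /= eq_sym andbC.
Qed.

Lemma ends_before_start p x l q : sorted event_le (p ++ (x, inr l) :: q) ->
  count (fun e => is_end e && (e.1 <= x)) (p ++ (x, inr l) :: q) = count is_end p.
Proof.
case/sorted_at_start => /allP px /allP qx; rewrite count_cat /= add0n.
rewrite [X in (_ + X)%N](_ : _ = 0%N) ?addn0; last first.
  apply/eqP; rewrite -leqn0 leqNgt -has_count; apply/hasPn => e /qx.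
  by rewrite /is_start leNgt; case: is_end => //=; rewrite orbF => ->.
by apply: eq_in_count => e /px ->; rewrite andbT.
Qed.

(** Strict because the start at [x] is itself counted; more starts at the same time may follow in
    [q]. *)
Lemma starts_upto_start p x l q : sorted event_le (p ++ (x, inr l) :: q) ->
  (count is_start p < count (fun e => is_start e && (e.1 <= x)%R) (p ++ (x, inr l) :: q))%N.
Proof.
case/sorted_at_start => /allP px _; rewrite count_cat /= lexx /=.
have -> : count (fun e => is_start e && (e.1 <= x)) p = count is_start p.
  by apply: eq_in_count => e /px ->; rewrite andbT.
by lia.
Qed.

(** * The ballot inequality when the period is cut at a peak *)

Section Ballot.
Variables (T : nat) (a b : I -> R) (s : seq (event R I)).
Hypothesis T_gt0 : (0 < T)%N.
Hypothesis a_range : forall i, 0 <= a i < T%:R.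
Hypothesis b_range : forall i, 0 <= b i < T%:R.
Hypothesis peak0 : forall t, 0 <= t < T%:R -> (tasks_at T a b t <= tasks_at T a b 0)%N.
Hypothesis s_perm : perm_eq s (events a b).
Hypothesis s_sorted : sorted event_le s.

(* Compare the loads at 0, where at most the wrapping tasks are in progress,
   and just after x. *)
Lemma starts_le_ends x : 0 <= x < T%:R ->
  (\sum_i (a i <= x)%R <= \sum_i (b i <= x)%R)%N.
Proof.
move=> /andP[x0 xT].
have [t /andP[xt tT] /allP gap] := gap_after (codom a ++ codom b) xT.
have tr : 0 <= t < T%:R by rewrite tT (le_trans x0 (ltW xt)).
have a_gap i : (a i <= t) = (a i <= x).
  by apply/eqP/gap; rewrite mem_cat codom_f.
have b_gap i : (b i <= t) = (b i <= x).
  by apply/eqP/gap; rewrite mem_cat codom_f orbT.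
have := tasks_at_gap T_gt0 a_range b_range tr.
have gapP i : a i != t /\ b i != t.
  split; apply/eqP => it; [have := a_gap i | have := b_gap i];
  by rewrite it lexx leNgt xt.
move/(_ gapP); have := tasks_at0_le T_gt0 a_range b_range; have := peak0 tr.
under [X in (_ + X)%N = _]eq_bigr => i _ do rewrite b_gap.
under [X in _ = (_ + X)%N]eq_bigr => i _ do rewrite a_gap.
by lia.
Qed.

(** The ends up to time [x] are those of [p], whereas the starts up to [x] exceed those of [p]. This
    turns the weak inequality between times into a strict one between prefixes. *)
Lemma ballot p x l q : s = p ++ (x, inr l) :: q ->
  (count is_start p < count is_end p)%N.
Proof.
move=> sE; have es : (x, inr l) \in s by rewrite sE mem_cat mem_head orbT.
have xr : 0 <= x < T%:R by rewrite (mem_events s_perm es : x = _).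
have := starts_le_ends xr.
rewrite -(count_ends (<=%R^~ x) s_perm) -(count_starts (<=%R^~ x) s_perm) /=.
have := s_sorted; rewrite sE => sorted_s.
have := ends_before_start sorted_s; have := starts_upto_start sorted_s.
by lia.
Qed.

End Ballot.

(** Matching an end directly to the start that follows amounts to pushing it and popping it at once,
    so the proofs can treat every end as a push. *)
Lemma prog_match_push Q arcs x k s : s != [::] ->
  value (prog_match Q arcs ((x, inl k) :: s)) = value (prog_match (k :: Q) arcs s).
Proof. by case: s => [|[y [k'|l]] s]. Qed.

(** Loop invariant. Stacked ends are no later than any remaining event, so a pop never produces a
    wrapping arc; the ballot condition keeps pops off the empty stack; the balance says that the
    remaining starts use up all stacked and remaining ends. *)
Lemma prog_matchP a b Q arcs s :
    sorted event_le s ->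
    (forall e, e \in s -> e.1 = match e.2 with inl k => b k | inr l => a l end) ->
    (forall k e, k \in Q -> e \in s -> b k <= e.1) ->
    (forall p x l q, s = p ++ (x, inr l) :: q ->
       (count is_start p < size Q + count is_end p)%N) ->
    count is_start s = (size Q + count is_end s)%N ->
    all (fun kl => b kl.1 <= a kl.2) arcs ->
  exists arcs', [/\ value (prog_match Q arcs s) = Some arcs',
    perm_eq (unzip1 arcs') (unzip1 arcs ++ Q ++ pmap end_task s),
    perm_eq (unzip2 arcs') (unzip2 arcs ++ pmap start_task s)
    & all (fun kl => b kl.1 <= a kl.2) arcs'].
Proof.
elim: s Q arcs => [|[x [k|l]] s IHs] Q arcs s_sorted times below ballot balance ok.
(* With no event left, the balance forces the stack to be empty: no end stays unmatched. *)
- by case: Q balance {below ballot} => // _; exists arcs; rewrite !cats0.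
(* An end is never the last event: by the balance, a start for it is still to come. *)
- have s_neq0 : s != [::] by apply/eqP => s0; move: balance; rewrite s0 /=; lia.
  have xk : x = b k := times _ (mem_head _ _).
  have /(_ event_le_trans)/allP x_min := order_path_min _ s_sorted.
  rewrite prog_match_push //.
  have [||||||arcs' [-> arcs1 arcs2 ok']] := IHs (k :: Q) arcs => //.
  + exact: path_sorted s_sorted.
  + by move=> e es; apply: times; rewrite inE es orbT.
  + move=> k' e; rewrite inE => /orP[/eqP->|kQ] es.
      by have /event_le_time := x_min e es; rewrite /= xk.
    by apply: below => //; rewrite inE es orbT.
  + move=> p y l q sE; have := ballot ((x, inl k) :: p) y l q.
    by rewrite sE /= => /(_ erefl); lia.
  + by move: balance => /=; lia.
  exists arcs'; split => //; apply: perm_trans arcs1 _.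
  by rewrite perm_cat2l /= -[k :: pmap _ s]cat1s perm_sym perm_catCA.
have xl : x = a l := times _ (mem_head _ _).
case: Q below ballot balance => [|k Q] below ballot balance.
  (* An empty stack contradicts the ballot condition for the empty prefix. *)
  by have := ballot [::] x l s erefl.
have [||||||arcs' [arcsE arcs1 arcs2 ok']] := IHs Q ((k, l) :: arcs) => //.
- exact: path_sorted s_sorted.
- by move=> e es; apply: times; rewrite inE es orbT.
- by move=> k' e kQ es; apply: below; rewrite inE ?kQ ?es orbT.
- move=> p y l' q sE; have := ballot ((x, inr l) :: p) y l' q.
  by rewrite sE /= => /(_ erefl); lia.
- by move: balance => /=; lia.
- by rewrite /= ok andbT -xl; apply: (below _ (x, inr l)); rewrite mem_head.
exists arcs'; split => //.
- apply: perm_trans arcs1 _.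
  by rewrite /= -[k :: Q ++ _]cat1s perm_sym perm_catCA.
- apply: perm_trans arcs2 _.
  by rewrite /= -[l :: pmap _ s]cat1s perm_sym perm_catCA.
Qed.

(** Transfers [prog_matchP] from the program, which lists its arcs, to the procedure, which collects
    a set. *)
Lemma match_eventsE Q arcs s :
  match_events Q [set ij in arcs]%SET s =
  omap (fun r => [set ij in r]%SET) (value (prog_match Q arcs s)).
Proof.
have setU1_seq kl (r : seq (I * I)) : (kl |: [set ij in r] = [set ij in kl :: r])%SET.
  by apply/setP => ij; rewrite !inE.
(* Induction on the length, since matching an end to the next start consumes two events. *)
have [n] := ubnP (size s); elim: n s Q arcs => // n IHn [|[x [k|l]] s] Q arcs //= sn.
  case: s sn => [|[y [k'|l]] s] //= sn.
    exact: (IHn ((y, inl k') :: s) (k :: Q)).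
  by rewrite setU1_seq IHn //; lia.
by case: Q => // k Q; rewrite setU1_seq IHn.
Qed.

End Events.

(** * Optimality *)

Section Optimality.
Variables (R : realType) (I : finType) (T : nat).
Hypothesis T_gt0 : (0 < T)%N.
Implicit Types (a b : I -> R) (t : R) (M : {set I * I}) (s : seq (event R I)).

(** Each task is the target of one arc and the source of one arc, so the two parts of the sum
    reindex along [snd] and [fst]. The value is thus common to all assignments. *)
Lemma assignment_sum M (f g : I -> R) : periodic_assignment M ->
  \sum_(ij in M) (f ij.2 - g ij.1) = \sum_i f i - \sum_i g i.
Proof.
case=> leaving entering; rewrite sumrB; congr (_ - _).
  rewrite (partition_big snd predT) //=; apply: eq_bigr => j _.
  have [i [ijM i_uniq]] := entering j; rewrite (big_pred1 (i, j)) // => -[i' j'] /=.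
  apply/andP/eqP => [[ijM' /eqP j'j]|[-> ->]] //.
  by rewrite j'j in ijM' *; rewrite (i_uniq _ ijM').
rewrite (partition_big fst predT) //=; apply: eq_bigr => i _.
have [j [ijM j_uniq]] := leaving i; rewrite (big_pred1 (i, j)) // => -[i' j'] /=.
apply/andP/eqP => [[ijM' /eqP i'i]|[-> ->]] //.
by rewrite i'i in ijM' *; rewrite (j_uniq _ ijM').
Qed.

Lemma uniq_map_inj (A B : eqType) (f : A -> B) (r : seq A) :
  uniq (map f r) -> {in r &, injective f}.
Proof.
elim: r => //= z r IHr /andP[fz_notin r_uniq] x y; rewrite !inE.
case/predU1P=> [->|xr] /predU1P[->|yr] // fxy; last exact: IHr.
- by case/negP: fz_notin; rewrite fxy map_f.
- by case/negP: fz_notin; rewrite -fxy map_f.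
Qed.

(** Both projections list every task without repetition: completeness yields an arc at each task,
    injectivity its uniqueness. *)
Lemma arcs_assignment (arcs : seq (I * I)) :
  perm_eq (unzip1 arcs) (enum I) -> perm_eq (unzip2 arcs) (enum I) ->
  periodic_assignment [set ij in arcs]%SET.
Proof.
move=> arcs1 arcs2.
have inj1 := uniq_map_inj (etrans (perm_uniq arcs1) (enum_uniq _)).
have inj2 := uniq_map_inj (etrans (perm_uniq arcs2) (enum_uniq _)).
split=> i.
  have : i \in unzip1 arcs by rewrite (perm_mem arcs1) mem_enum.
  case/mapP => -[i' j] ijM /= {i}->; exists j; split=> [|j']; rewrite inE //.
  by move=> ijM'; have [] := inj1 _ _ ijM ijM' erefl.
have : i \in unzip2 arcs by rewrite (perm_mem arcs2) mem_enum.
case/mapP => -[j i'] ijM /= {i}->; exists j; split=> [|j']; rewrite inE //.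
by move=> ijM'; have [] := inj2 _ _ ijM ijM' erefl.
Qed.

Lemma no_wrap_optimal a b M :
  (forall i, 0 <= a i < T%:R) -> (forall i, 0 <= b i < T%:R) ->
  periodic_assignment M -> (forall ij, ij \in M -> b ij.1 <= a ij.2) ->
  pap_optimal T a b M.
Proof.
move=> ar br assign no_wrap; split=> // M' assign'.
have -> : total_time T a b M = \sum_i a i - \sum_i b i.
  rewrite -(assignment_sum _ _ assign); apply: eq_bigr => ij /no_wrap ij_le.
  by rewrite /transition_time pmod_sub // ltNge ij_le.
rewrite -(assignment_sum _ _ assign').
by apply: ler_sum => ij _; apply: pmod_sub_ge.
Qed.

Lemma pap_optimal_shift t a b M :
  pap_optimal T (shift T t a) (shift T t b) M -> pap_optimal T a b M.
Proof.
have total M' : total_time T (shift T t a) (shift T t b) M' = total_time T a b M'.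
  by apply: eq_bigr => ij _; rewrite transition_time_shift.
by case=> assign opt; split=> // M' /opt; rewrite !total.
Qed.

Lemma shift_range t (f : I -> R) i : 0 <= shift T t f i < T%:R.
Proof. exact: pmod_range. Qed.

Lemma ssm_correct a b t s : peak T a b t ->
    sorted_events (shift T t a) (shift T t b) s ->
  exists arcs, [/\ value (prog_match [::] [::] s) = Some arcs,
    match_events [::] finset.set0 s = Some [set ij in arcs]%SET
    & pap_optimal T a b [set ij in arcs]%SET].
Proof.
move=> [tr t_load] [s_perm s_sorted].
have [ar br] := (shift_range t a, shift_range t b).
have peak0 x : 0 <= x < T%:R ->
    (tasks_at T (shift T t a) (shift T t b) x <=
     tasks_at T (shift T t a) (shift T t b) 0)%N.
  (* After the shift, the load at 0 is the original load at the peak [t]. *)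
  move=> xr; rewrite !tasks_at_shift // add0r [pmod T t]pmod_id // t_load.
  by apply: tasks_at_le_load => //; apply: pmod_range.
have [|||||arcs [arcsE arcs1 arcs2 arcs_ok]] :=
    @prog_matchP R I (shift T t a) (shift T t b) [::] [::] s s_sorted.
- by move=> e; apply: mem_events.
- by [].
- by move=> p x l q /(ballot T_gt0 ar br peak0 s_perm s_sorted).
- by rewrite (count_is_start s_perm) (count_is_end s_perm).
- by [].
exists arcs; split=> //.
  have -> : finset.set0 = [set ij in ([::] : seq (I * I))]%SET.
    by apply/setP => ij; rewrite !inE.
  by rewrite match_eventsE arcsE.
apply: (@pap_optimal_shift t); apply: no_wrap_optimal => //.
  apply: arcs_assignment.
    exact: perm_trans arcs1 (perm_ends s_perm).
  exact: perm_trans arcs2 (perm_starts s_perm).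
by move=> ij; rewrite inE => /(allP arcs_ok).
Qed.

End Optimality.

(** * Merge sort *)

Section Sort.
Variables (R : realType) (I : finType).
Implicit Types (e : event R I) (s : seq (event R I)) (ss : seq (seq (event R I))).

Lemma value_bind (A B : Type) (m : timed A) (f : A -> timed B) :
  value (bind m f) = value (f (value m)).
Proof. by []. Qed.

Lemma time_bind (A B : Type) (m : timed A) (f : A -> timed B) :
  time (bind m f) = (time m + time (f (value m)))%N.
Proof. by []. Qed.

Lemma value_call (A : Type) (m : timed A) : value (call m) = value m.
Proof. by []. Qed.

Lemma time_call (A : Type) (m : timed A) : time (call m) = (time m).+1.
Proof. by []. Qed.

Lemma value_prog_le e1 e2 : value (prog_le e1 e2) = event_le e1 e2.
Proof. by rewrite /prog_le /event_le /value /=; case: ltgtP. Qed.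

Lemma time_prog_le e1 e2 : (time (prog_le e1 e2) <= 3)%N.
Proof. by rewrite /prog_le /time /=; case: ltgtP. Qed.

Lemma prog_merge_cons e1 s1 e2 s2 :
  prog_merge (e1 :: s1) (e2 :: s2) =
  call (let* le := prog_le e1 e2 in
        if le then let* r := prog_merge s1 (e2 :: s2) in ret (e1 :: r)
        else let* r := prog_merge (e1 :: s1) s2 in ret (e2 :: r)).
Proof. by []. Qed.

Lemma value_prog_merge s1 s2 :
  value (prog_merge s1 s2) = merge event_le s1 s2.
Proof.
elim: s1 s2 => [|e1 s1 IHs1]; first by case.
elim=> // e2 s2 IHs2.
have -> : merge event_le (e1 :: s1) (e2 :: s2) =
  if event_le e1 e2 then e1 :: merge event_le s1 (e2 :: s2)
  else e2 :: merge event_le (e1 :: s1) s2 by [].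
rewrite -value_prog_le -IHs1 -IHs2 prog_merge_cons value_call value_bind.
by case: (value (prog_le e1 e2)).
Qed.

Lemma time_prog_merge_cons e1 s1 e2 s2 :
  time (prog_merge (e1 :: s1) (e2 :: s2)) =
  (time (prog_le e1 e2) +
   if value (prog_le e1 e2) then time (prog_merge s1 (e2 :: s2))
   else time (prog_merge (e1 :: s1) s2)).+1.
Proof.
rewrite prog_merge_cons time_call time_bind; congr (_ + _).+1.
by case: (value (prog_le e1 e2)); apply: addn0.
Qed.

(** Each element output costs one call and a comparison of at most 3 units; the final call adds
    1. *)
Lemma time_prog_merge s1 s2 :
  (time (prog_merge s1 s2) <= 4 * (size s1 + size s2) + 1)%N.
Proof.
elim: s1 s2 => [|e1 s1 IHs1]; first by move=> s2; rewrite /time /=; lia.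
elim=> [|e2 s2 IHs2]; first by rewrite /time /=; lia.
have := time_prog_le e1 e2; have := IHs1 (e2 :: s2); move: IHs2.
rewrite time_prog_merge_cons.
by case: (value (prog_le e1 e2)); rewrite [size (e1 :: _)]/= [size (e2 :: _)]/=; lia.
Qed.

Lemma value_prog_sort_push s1 ss :
  value (prog_sort_push s1 ss) = path.merge_sort_push event_le s1 ss.
Proof.
elim: ss s1 => //= -[|e s2] ss IHss s1 //=.
rewrite -value_prog_merge.
by rewrite -IHss.
Qed.

Lemma value_prog_sort_pop s1 ss :
  value (prog_sort_pop s1 ss) = path.merge_sort_pop event_le s1 ss.
Proof.
by elim: ss s1 => //= s2 ss IHss s1; rewrite -value_prog_merge -IHss.
Qed.

Lemma value_prog_sort ss s :
  value (prog_sort ss s) = path.sort_rec1 event_le ss s.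
Proof.
elim: s ss => [|e s IHs] ss /=; first by rewrite -value_prog_sort_pop.
by rewrite -value_prog_sort_push -IHs.
Qed.

Lemma prog_sort_correct a b s : perm_eq s (events a b) ->
  sorted_events a b (value (prog_sort [::] s)).
Proof.
move=> s_perm; rewrite value_prog_sort -sortE; split.
  by rewrite (permPl (permEl (perm_sort _ _))).
exact/sort_sorted/event_le_total.
Qed.

(** The sorted runs form a binary counter: the entry at level [i] is a digit, and pushing an event
    is an increment whose carries are merges. *)
Fixpoint binary_sizes i ss : bool :=
  if ss is s :: ss' then
    ((s == [::]) || (size s == 2 ^ i)%N) && binary_sizes i.+1 ss'
  else true.

(* An element at level i has taken part in i merges, each of them charged at
   most 5 units per element. *)
Fixpoint work i ss : nat :=
  if ss is s :: ss' then (5 * i * size s + work i.+1 ss')%N else 0%N.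

Definition total ss : nat := size (flatten ss).

(** Amortized analysis with [work] as potential: moving a merged run up one level raises the
    potential by 5 per element, which pays for the merge and its call. Only the final call, which
    fills an empty level, remains as the 1 on the right. *)
Lemma prog_sort_pushP i K s1 ss (r := value (prog_sort_push s1 ss)) :
    size s1 = (2 ^ i)%N -> binary_sizes i ss ->
    (size ss <= K)%N -> (total ss + size s1 < 2 ^ (i + K))%N ->
  [/\ binary_sizes i r, (size r <= K)%N, total r = (total ss + size s1)%N &
    (time (prog_sort_push s1 ss) + work i ss + 5 * i * size s1 <= work i r + 1)%N].
Proof.
rewrite {}/r; elim: ss i K s1 => [|s2 ss IHss] i K s1 s1_size.
  rewrite /time /value /total /= cats0 s1_size eqxx orbT => _ _ lt.
  (* A new level needs [K] positive: otherwise [s1], of size [2 ^ i], would already exceed the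
     capacity. *)
  by split=> //; [case: K lt => //; rewrite add0n addn0 ltnn|lia].
case: s2 => [|e s2].
  move=> /= ss_bin ss_size; rewrite /time /value /total /= size_cat s1_size eqxx orbT => lt.
  by split=> //; [rewrite addnC|lia].
move=> /andP[s2_size ss_bin]; case: K => // K ss_size.
set s3 := prog_merge (e :: s2) s1 => lt.
have s3_size : size (value s3) = (size (e :: s2) + size s1)%N.
  by rewrite value_prog_merge size_merge size_cat.
have s3_size2 : size (value s3) = (2 ^ i.+1)%N.
  by rewrite s3_size (eqP s2_size) s1_size expnS; lia.
have total_cons : total ((e :: s2) :: ss) = (size (e :: s2) + total ss)%N.
  by rewrite /total /= size_cat.
have [|r_bin r_size r_total r_time] := IHss i.+1 K (value s3) s3_size2 ss_bin ss_size.
  by move: lt; rewrite total_cons s3_size addSnnS; lia.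
have s3_time := time_prog_merge (e :: s2) s1; rewrite -/s3 in s3_time.
have r_cons : value (prog_sort_push s1 ((e :: s2) :: ss)) =
  [::] :: value (prog_sort_push (value s3) ss) by [].
split.
- exact: r_bin.
- exact: r_size.
- by rewrite r_cons [LHS]r_total total_cons s3_size; lia.
- have -> : time (prog_sort_push s1 ((e :: s2) :: ss)) =
    (time s3 + (time (prog_sort_push (value s3) ss) + 0)).+1%N by [].
  (* Both runs are nonempty, so for their total size n at least 2, merge and call cost at most 4 n +
     2, hence at most 5 n. *)
  have s1_gt0 : (0 < size s1)%N by rewrite s1_size expn_gt0.
  rewrite r_cons; move: r_time s3_time; rewrite s3_size.
  move: (prog_sort_push (value s3) ss) (time s3) => r t3 /=.
  by nia.
Qed.

(** The final merges happen once per level, so charging each of them for all elements is good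
    enough. *)
Lemma time_prog_sort_pop s1 ss :
  (time (prog_sort_pop s1 ss) <= (4 * (size s1 + total ss) + 2) * size ss + 1)%N.
Proof.
elim: ss s1 => [|s2 ss IHss] s1; first by rewrite muln0.
have -> : time (prog_sort_pop s1 (s2 :: ss)) =
  (time (prog_merge s2 s1) + time (prog_sort_pop (value (prog_merge s2 s1)) ss)).+1%N.
  by [].
have := IHss (value (prog_merge s2 s1)); have := time_prog_merge s2 s1.
rewrite value_prog_merge size_merge size_cat.
have -> : total (s2 :: ss) = (size s2 + total ss)%N by rewrite /total /= size_cat.
by rewrite /=; nia.
Qed.

Lemma work_le i K ss : (size ss + i <= K)%N -> (work i ss <= 5 * K * total ss)%N.
Proof.
elim: ss i => //= s ss IHss i sizes.
have := IHss i.+1; rewrite addnS => /(_ sizes).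
by rewrite /total /= size_cat; nia.
Qed.

(** Each event pays 2 units for its own calls. The factor 9 consists of 5 per level from [work] and
    4 per level from the final merges. *)
Lemma time_prog_sort_rec K ss s :
    binary_sizes 0 ss -> (size ss <= K)%N -> (total ss + size s < 2 ^ K)%N ->
  (time (prog_sort ss s) + work 0 ss <=
   2 * size s + 2 + (9 * (total ss + size s) + 2) * K)%N.
Proof.
elim: s ss => [|e s IHs] ss ss_bin ss_size lt.
  have -> : time (prog_sort ss [::]) = (time (prog_sort_pop [::] ss)).+1 by [].
  have := time_prog_sort_pop [::] ss; have := @work_le 0 K ss.
  by rewrite addn0 => /(_ ss_size) /=; nia.
have [|r_bin r_size r_total r_time] := @prog_sort_pushP 0 K [:: e] ss erefl ss_bin ss_size.
  by rewrite add0n; move: lt => /=; lia.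
have -> : time (prog_sort ss (e :: s)) =
  (time (prog_sort_push [:: e] ss) +
   time (prog_sort (value (prog_sort_push [:: e] ss)) s)).+1%N by [].
have := IHs _ r_bin r_size; rewrite r_total [size [:: e]]/= addn1 addSnnS.
move=> /(_ lt); move: r_time; rewrite muln0 mul0n addn0 [size (e :: s)]/=.
move: (prog_sort_push [:: e] ss) => p; move: (prog_sort (value p) s) => q.
by lia.
Qed.

Lemma time_prog_sort K s : (0 < K)%N -> (size s < 2 ^ K)%N ->
  (time (prog_sort [::] s) <= (11 * size s + 4) * K)%N.
Proof.
move=> K_gt0 lt; have := @time_prog_sort_rec K [::] s isT (leq0n K) lt.
by rewrite /= /total /=; nia.
Qed.

End Sort.

(** * Sweep *)

Section Sweep.
Context {R : realType} {I : finType}.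
Implicit Types (a b : I -> R) (p q s : seq (event R I)) (t x : R).

(** An integer, since a prefix may hold more ends than starts. *)
Definition balance s : int := (count is_start s)%:Z - (count is_end s)%:Z.

(** The default [T] closes the gap after the last event. *)
Definition next_time (T : R) s : R := if s is (y, _) :: _ then y else T.

(* m is the value of kmax at the end of the sweep. *)
Lemma prog_sweepP (T : R) s (k kmax : int) t :
  let r := value (prog_sweep T s k kmax t) in
  exists m : int, [/\ kmax <= m,
    forall p x l q, s = p ++ (x, inr l) :: q -> k + balance p + 1 <= m &
    (m = kmax /\ r = t) \/
    kmax < m /\ exists p x l q, [/\ s = p ++ (x, inr l) :: q,
      k + balance p + 1 = m & r = (x + next_time T q) / 2]].
Proof.
elim: s k kmax t => [|[x [i|i]] s IHs] k kmax t.
- by exists kmax; split=> //; [case | left].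
- have -> : value (prog_sweep T ((x, inl i) :: s) k kmax t) =
    value (prog_sweep T s (k - 1) kmax t) by [].
  have balance_end p : k + balance ((x, inl i) :: p) = k - 1 + balance p.
    by rewrite /balance /=; lia.
  have [m [m_ge m_max m_eq]] := IHs (k - 1) kmax t; exists m; split=> //.
    move=> [|_ p] y l q //= [<- sE]; rewrite balance_end; exact: m_max sE.
  case: m_eq => [|[m_gt [p [y [l [q [sE mE rE]]]]]]]; first by left.
  right; split=> //; exists ((x, inl i) :: p), y, l, q; split=> //.
    by rewrite sE.
  by rewrite balance_end.
have balance_start p : k + balance ((x, inr i) :: p) = k + 1 + balance p.
  by rewrite /balance /=; lia.
have -> : value (prog_sweep T ((x, inr i) :: s) k kmax t) =
  if kmax < k + 1
  then value (prog_sweep T s (k + 1) (k + 1) ((x + next_time T s) / 2))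
  else value (prog_sweep T s (k + 1) kmax t).
  by rewrite /value /=; case: ifP.
have lift_max m : k + 1 <= m ->
    (forall p y l q, s = p ++ (y, inr l) :: q -> k + 1 + balance p + 1 <= m) ->
    forall p y l q, (x, inr i) :: s = p ++ (y, inr l) :: q -> k + balance p + 1 <= m.
  move=> m_ge m_max [|e p] y l q //=; first by rewrite /balance subrr addr0.
  by case=> <- sE; rewrite balance_start; apply: m_max sE.
case: ltP => k_kmax.
  have [m [m_ge m_max m_eq]] := IHs (k + 1) (k + 1) ((x + next_time T s) / 2).
  exists m; split; [lia | exact: lift_max |].
  right; split; first by lia.
  case: m_eq => [[-> ->]|[m_gt [p [y [l [q [sE mE rE]]]]]]].
    (* No later start improves on the head, which therefore is the record itself. *)
    by exists [::], x, i, s; split=> //; rewrite /balance subrr addr0.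
  exists ((x, inr i) :: p), y, l, q; split=> //; first by rewrite sE.
  by rewrite balance_start.
have [m [m_ge m_max m_eq]] := IHs (k + 1) kmax t.
exists m; split=> //; first by apply: lift_max => //; lia.
case: m_eq => [|[m_gt [p [y [l [q [sE mE rE]]]]]]]; first by left.
right; split=> //; exists ((x, inr i) :: p), y, l, q; split=> //.
  by rewrite sE.
by rewrite balance_start.
Qed.

(** A start costs at most 5: the call, the increment, the comparison and two operations for the
    midpoint. *)
Lemma time_prog_sweep (T : R) s (k kmax : int) t :
  (time (prog_sweep T s k kmax t) <= 5 * size s + 1)%N.
Proof.
elim: s k kmax t => [|[x [i|i]] s IHs] k kmax t //.
  have -> : time (prog_sweep T ((x, inl i) :: s) k kmax t) =
    (1 + time (prog_sweep T s (k - 1) kmax t)).+1%N by [].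
  by have := IHs (k - 1) kmax t; rewrite [size (_ :: s)]/=; lia.
have -> : time (prog_sweep T ((x, inr i) :: s) k kmax t) =
  (2 + if (kmax < k + 1)%R
   then 2 + time (prog_sweep T s (k + 1) (k + 1) ((x + next_time T s) / 2))
   else time (prog_sweep T s (k + 1) kmax t)).+1%N.
  by rewrite /time /=; case: ifP.
have := IHs (k + 1) (k + 1) ((x + next_time T s) / 2).
by have := IHs (k + 1) kmax t; rewrite [size (_ :: s)]/=; case: ifP; lia.
Qed.

Lemma count_cut a b s p q t :
    perm_eq s (events a b) -> s = p ++ q ->
    all (fun e => e.1 <= t) p -> all (fun e => t < e.1) q ->
  (\sum_i (a i <= t)%R)%N = count is_start p /\
  (\sum_i (b i <= t)%R)%N = count is_end p.
Proof.
move=> s_perm sE /allP pt /allP qt.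
rewrite -(count_ends (<=%R^~ t) s_perm) -(count_starts (<=%R^~ t) s_perm) /=.
have cut (P : pred (event R I)) : count (fun e => P e && (e.1 <= t)) s = count P p.
  rewrite sE count_cat [X in (_ + X)%N](_ : _ = 0%N) ?addn0; last first.
    apply/eqP; rewrite -leqn0 leqNgt -has_count; apply/hasPn => e /qt.
    by rewrite ltNge => /negbTE ->; rewrite andbF.
  by apply: eq_in_count => e /pt ->; rewrite andbT.
by rewrite !cut.
Qed.

Lemma peak_of_max (T : nat) a b t : (0 < T)%N -> 0 <= t < T%:R ->
  (forall x, 0 <= x < T%:R -> (tasks_at T a b x <= tasks_at T a b t)%N) ->
  peak T a b t.
Proof.
move=> T_gt0 tr t_max; split=> //; apply/eqP; rewrite eqn_leq tasks_at_le_load //=.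
by have [x [xr <-]] := exists_peak T_gt0 a b; apply: t_max.
Qed.

(** * The sweep returns a peak *)

Section Peak.
Variables (T : nat) (a b : I -> R) (s : seq (event R I)).
Hypothesis T_gt0 : (0 < T)%N.
Hypothesis I_gt0 : (0 < #|I|)%N.
Hypothesis a_range : forall i, 0 <= a i < T%:R.
Hypothesis b_range : forall i, 0 <= b i < T%:R.
Hypothesis s_events : sorted_events a b s.

Let wrapping : int := ((\sum_i (b i < a i)%R)%N)%:Z.

Lemma balance_rcons p e :
  balance (rcons p e) = balance p + (if is_end e then -1 else 1).
Proof.
by rewrite /balance -cats1 !count_cat /= /is_start; case: is_end => /=; lia.
Qed.

(* The count is largest after a start. Without any start it is at most its
   value at time 0, which is also the value at T, after all starts. *)
Lemma balance_max (m : int) :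
    (forall p x l q, s = p ++ (x, inr l) :: q -> wrapping + balance p + 1 <= m) ->
  forall p q, s = p ++ q -> wrapping + balance p <= m.
Proof.
move=> after_start; have [s_perm _] := s_events.
have some_start p q : s = p ++ q -> has is_start p -> wrapping + balance p <= m.
  (* Removing trailing ends only raises the balance, until the prefix finishes with a start. *)
  elim/last_ind: p q => // p [x [k|l]] IHp q sE.
    rewrite has_rcons /= balance_rcons /= => p_start.
    by have := IHp ((x, inl k) :: q) _ p_start; rewrite -cat_rcons => /(_ sE); lia.
  rewrite cat_rcons in sE => _; rewrite balance_rcons /= addrA.
  exact: after_start sE.
have W_le : wrapping <= m.
  have := some_start s [::]; rewrite cats0 has_count (count_is_start s_perm).
  by move/(_ erefl I_gt0); rewrite /balance (count_is_start s_perm) (count_is_end s_perm); lia.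
move=> p q sE; have [|] := boolP (has is_start p); first exact: some_start sE.
by rewrite has_count -leqNgt leqn0 => /eqP p0; rewrite /balance p0; lia.
Qed.

Lemma tasks_at_le_max (m : int) t : 0 <= t < T%:R ->
    (forall p q, s = p ++ q -> wrapping + balance p <= m) ->
  (tasks_at T a b t)%:Z <= m.
Proof.
move=> tr m_max; have [s_perm s_sorted] := s_events.
have [p [q [sE pt qt]]] := sorted_cut t s_sorted.
have [aE bE] := count_cut s_perm sE pt qt.
have := tasks_at_le T_gt0 a_range b_range tr; have := m_max p q sE.
by rewrite aE bE /balance /wrapping; lia.
Qed.

(** The midpoint of a nonempty gap avoids all event times, so [tasks_at_gap] gives the load
    exactly. *)
Lemma tasks_at_after_start p x l q : s = p ++ (x, inr l) :: q ->
    x < next_time T%:R q ->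
  let t := (x + next_time T%:R q) / 2 in
  0 <= t < T%:R /\ (tasks_at T a b t)%:Z = wrapping + balance p + 1.
Proof.
move=> sE x_next t; have [s_perm s_sorted] := s_events.
have [es xr] : (x, inr l) \in s /\ 0 <= x < T%:R.
  have es : (x, inr l) \in s by rewrite sE mem_cat mem_head orbT.
  by split=> //; rewrite (mem_events s_perm es : x = _).
have next_T : next_time T%:R q <= T%:R.
  case: q sE {x_next t} => [|[y k] q] sE //=.
  have : (y, k) \in s by rewrite sE mem_cat !inE eqxx !orbT.
  move/(mem_events s_perm) => /= ->.
  by case: k {sE} => k; [have /andP[_ /ltW] := b_range k | have /andP[_ /ltW] := a_range k].
have tr : 0 <= t < T%:R by rewrite /t; lra.
have x_t : x < t by rewrite /t; lra.
have sorted_s := s_sorted; rewrite sE in sorted_s.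
have [/allP px _] := sorted_at_start sorted_s.
have p_t : all (fun e => e.1 < t) (rcons p (x, inr l)).
  rewrite all_rcons /= x_t; apply/allP => e ep; apply: le_lt_trans (px e ep) x_t.
have q_t : all (fun e => t < e.1) q.
  have : path event_le (x, inr l) q by move: sorted_s; rewrite sorted_cat_cons => /andP[].
  have : t < next_time T%:R q by rewrite /t; lra.
  case: (q) => //= -[y k] q' t_y /andP[_ yq]; rewrite t_y /=.
  have /(_ event_le_trans)/= := order_path_min _ yq.
  by apply: sub_all => e /event_le_time; apply: lt_le_trans.
split=> //; rewrite -cat_rcons in sE.
have p_le : all (fun e => e.1 <= t) (rcons p (x, inr l)).
  by apply: sub_all p_t => e /ltW.
have [aE bE] := count_cut s_perm sE p_le q_t.
have event_neq e : e \in s -> e.1 != t.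
  rewrite sE mem_cat => /orP[/(allP p_t)|/(allP q_t)] et; rewrite ?(lt_eqF et) //.
  by rewrite gt_eqF.
have gap i : a i != t /\ b i != t.
  split; [apply: (event_neq (a i, inr i)) | apply: (event_neq (b i, inl i))];
  by rewrite (perm_mem s_perm) mem_cat !map_f ?mem_enum ?orbT.
have := tasks_at_gap T_gt0 a_range b_range tr gap; have := balance_rcons p (x, inr l).
rewrite aE bE /balance /wrapping [is_end _]/=.
move: (tasks_at _ _ _ _) (\sum_i _)%N (count _ _) (count _ _) (count _ _) (count _ _).
by rewrite /=; clear; lia.
Qed.

Lemma prog_sweep_peak : peak T a b (value (prog_sweep T%:R s wrapping 0 0)).
Proof.
have [m [m_ge0 m_start m_eq]] := prog_sweepP T%:R s wrapping 0 0.
have m_max := balance_max m_start.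
have upper x (xr : 0 <= x < T%:R) := tasks_at_le_max xr m_max.
case: m_eq => [[m0 ->]|[m_gt0 [p [x [l [q [sE mE ->]]]]]]].
  (* No count exceeded 0, so every load is 0 and the initial value 0 of [tmax] is a peak. *)
  apply: peak_of_max => //; first by rewrite lexx ltr0n.
  by move=> x /upper; lia.
have [s_perm s_sorted] := s_events.
(* The gap after the record start is nonempty: at the same time, an end would have been sorted
   earlier, and another start would beat the record. *)
have x_next : x < next_time T%:R q.
  case: q sE => [|[y k] q] sE /=.
    have es : (x, inr l) \in s by rewrite sE mem_cat mem_head orbT.
    by rewrite (mem_events s_perm es : x = _); have /andP[] := a_range l.
  have sorted_s := s_sorted; rewrite sE in sorted_s.
  have [_ /= /andP[/orP[//|/andP[k_start _]] _]] := sorted_at_start sorted_s.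
  case: k k_start sE {sorted_s} => // k _ sE.
  have := m_start (rcons p (x, inr l)) y k q; rewrite cat_rcons => /(_ sE).
  by rewrite balance_rcons /=; lia.
have [tr tE] := tasks_at_after_start sE x_next.
by apply: peak_of_max => // y /upper; lia.
Qed.

End Peak.
End Sweep.

(** * Running the program *)

Section Program.
Context {R : realType} {I : finType}.
Implicit Types (a b : I -> R) (s : seq (event R I)) (t x y : R).

Lemma value_prog_sub (T : nat) x y : (0 < T)%N ->
    0 <= x < T%:R -> 0 <= y < T%:R ->
  value (prog_sub T%:R x y) = pmod T (x - y).
Proof.
move=> T_gt0 xr yr; rewrite pmod_sub // -subr_lt0 /prog_sub /value /=.
by case: ifP.
Qed.

Lemma time_prog_sub (T x y : R) : (time (prog_sub T x y) <= 4)%N.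
Proof. by rewrite /prog_sub /time /=; case: ifP. Qed.

(** Stated for any task list to allow induction; only a permutation, since the program interleaves
    ends and starts. *)
Lemma prog_events_rec (T : nat) t a b tasks : (0 < T)%N -> 0 <= t < T%:R ->
    (forall i, 0 <= a i < T%:R) -> (forall i, 0 <= b i < T%:R) ->
  perm_eq (value (prog_events T%:R t a b tasks))
    ([seq (shift T t b k, inl k) | k <- tasks] ++
     [seq (shift T t a l, inr l) | l <- tasks]).
Proof.
move=> T_gt0 tr ar br; elim: tasks => // i tasks IHtasks.
have -> : value (prog_events T%:R t a b (i :: tasks)) =
  [:: (value (prog_sub T%:R (b i) t), inl i), (value (prog_sub T%:R (a i) t), inr i) &
   value (prog_events T%:R t a b tasks)] by [].
rewrite !value_prog_sub // [map _ (_ :: _)]/= [map _ (_ :: _)]/= cat_cons perm_cons.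
rewrite -[_ :: map _ _]cat1s perm_sym perm_catCA.
by rewrite perm_sym perm_cons.
Qed.

Lemma perm_prog_events (T : nat) t a b : (0 < T)%N -> 0 <= t < T%:R ->
    (forall i, 0 <= a i < T%:R) -> (forall i, 0 <= b i < T%:R) ->
  perm_eq (value (prog_events T%:R t a b (enum I))) (events (shift T t a) (shift T t b)).
Proof. exact: prog_events_rec. Qed.

Lemma time_prog_events (T : R) t a b tasks :
  (time (prog_events T t a b tasks) <= 9 * size tasks + 1)%N.
Proof.
elim: tasks => // i tasks IHtasks.
have -> : time (prog_events T t a b (i :: tasks)) =
  (time (prog_sub T (a i) t) + (time (prog_sub T (b i) t) +
   (time (prog_events T t a b tasks) + 0))).+1%N by [].
have := time_prog_sub T (a i) t; have := time_prog_sub T (b i) t.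
by rewrite [size (_ :: _)]/=; lia.
Qed.

Lemma value_prog_wrapping a b tasks :
  value (prog_wrapping a b tasks) = (count (fun i => b i < a i) tasks)%:Z.
Proof.
elim: tasks => // i tasks; rewrite [RHS]/= PoszD => <-; rewrite /value /=.
by case: ifP => _ /=; rewrite ?add0r // addrC.
Qed.

Lemma time_prog_wrapping a b tasks :
  (time (prog_wrapping a b tasks) <= 3 * size tasks + 1)%N.
Proof.
elim: tasks => // i tasks; rewrite /time /=; case: ifP => _ /=; lia.
Qed.

Lemma time_prog_match Q arcs s : (time (@prog_match R I Q arcs s) <= size s + 1)%N.
Proof.
have [n] := ubnP (size s); elim: n s Q arcs => // n IHn [|[x [k|l]] s] Q arcs //= sn.
  case: s sn => [|[y [k'|l]] s] //= sn.
    by have := IHn ((y, inl k') :: s) (k :: Q) arcs sn; rewrite /time /=; lia.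
  have ltn : (size s < n)%N by lia.
  by have := IHn s Q ((k, l) :: arcs) ltn; rewrite /time /=; lia.
case: Q => [|k Q]; first by rewrite /time /=; lia.
by have := IHn s Q ((k, l) :: arcs) sn; rewrite /time /=; lia.
Qed.

Section Run.
Variables (T : nat) (a b : I -> R).
Hypothesis T_gt0 : (0 < T)%N.
Hypothesis a_range : forall i, 0 <= a i < T%:R.
Hypothesis b_range : forall i, 0 <= b i < T%:R.

Let tasks := enum I.
Let s := value (prog_sort [::] (value (prog_events T%:R 0 a b tasks))).
Let k := value (prog_wrapping a b tasks).
Let t := value (prog_sweep T%:R s k 0 0).
Let r := value (prog_sort [::] (value (prog_events T%:R t a b tasks))).

Lemma value_ssm_program :
  value (ssm_program T%:R a b tasks) = value (prog_match [::] [::] r).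
Proof. by []. Qed.

Lemma time_ssm_program : time (ssm_program T%:R a b tasks) =
  (time (prog_events T%:R 0 a b tasks) +
   (time (prog_sort [::] (value (prog_events T%:R 0 a b tasks))) +
    (time (prog_wrapping a b tasks) +
     (time (prog_sweep T%:R s k 0 0) +
      (time (prog_events T%:R t a b tasks) +
       (time (prog_sort [::] (value (prog_events T%:R t a b tasks))) +
        time (prog_match [::] [::] r)))))))%N.+1.
Proof. by []. Qed.

(** The first pass shifts by 0, which fixes every time in the period. *)
Lemma initial_events : sorted_events a b s.
Proof.
apply: prog_sort_correct.
have zero : 0 <= (0 : R) < T%:R by rewrite lexx ltr0n.
have shift0 (f : I -> R) (fr : forall i, 0 <= f i < T%:R) : shift T 0 f = f.
  by apply/funext => i; rewrite /shift subr0 pmod_id.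
by have := perm_prog_events T_gt0 zero a_range b_range; rewrite !shift0.
Qed.

Lemma run_peak : (0 < #|I|)%N -> peak T a b t.
Proof.
move=> I_gt0; rewrite /t /k value_prog_wrapping.
have -> : count (fun i => b i < a i) tasks = (\sum_i (b i < a i)%R)%N.
  by rewrite -sum1_count big_mkcond big_enum.
exact: prog_sweep_peak T_gt0 I_gt0 a_range b_range initial_events.
Qed.

Lemma run_events : (0 < #|I|)%N -> sorted_events (shift T t a) (shift T t b) r.
Proof.
by move=> /run_peak[tr _]; apply/prog_sort_correct/perm_prog_events.
Qed.

Lemma run_outcome : (0 < #|I|)%N ->
  exists arcs, value (ssm_program T%:R a b tasks) = Some arcs /\
    ssm_outcome T a b [set ij in arcs]%SET.
Proof.
move=> I_gt0; have [tP rP] := (run_peak I_gt0, run_events I_gt0).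
have [arcs [arcsE outE _]] := ssm_correct T_gt0 tP rP.
by exists arcs; split; [rewrite value_ssm_program | exists t, r].
Qed.

Lemma size_events (f g : I -> R) s' : perm_eq s' (events f g) -> size s' = (2 * #|I|)%N.
Proof. by move/perm_size->; rewrite size_cat !(size_map _ (enum I)) -cardE addnn mul2n. Qed.

(** With n tasks and 2 n events, the two sorts cost at most 52 n K, and everything else at most 39
    n; these add up to 91 n K as [K] is positive. *)
Lemma run_time K : (0 < #|I|)%N -> (0 < K)%N -> (2 * #|I| < 2 ^ K)%N ->
  (time (ssm_program T%:R a b tasks) <= 91 * (#|I| * K))%N.
Proof.
move=> I_gt0 K_gt0 ltK; have [tr _] := run_peak I_gt0.
have zero : 0 <= (0 : R) < T%:R by rewrite lexx ltr0n.
have size1 := size_events (perm_prog_events T_gt0 zero a_range b_range).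
have size2 := size_events (perm_prog_events T_gt0 tr a_range b_range).
have size_s := size_events initial_events.1.
have size_r := size_events (run_events I_gt0).1.
have sort1 := time_prog_sort K_gt0 (etrans (congr1 (fun m => (m < 2 ^ K)%N) size1) ltK).
have sort2 := time_prog_sort K_gt0 (etrans (congr1 (fun m => (m < 2 ^ K)%N) size2) ltK).
have ev1 := time_prog_events T%:R 0 a b tasks.
have ev2 := time_prog_events T%:R t a b tasks.
have wr := time_prog_wrapping a b tasks.
have sw := time_prog_sweep T%:R s k 0 0.
have ma := time_prog_match [::] [::] r.
rewrite time_ssm_program; move: ev1 ev2 wr sw ma sort1 sort2.
rewrite size1 size2 size_s size_r (_ : size tasks = #|I|) -?cardE //.
move: #|I| I_gt0 => n n_gt0.
move: (time _) (time _) (time _) (time _) (time _) (time _) (time _).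
by clear -n_gt0 K_gt0; nia.
Qed.

End Run.
End Program.

(** * From binary to natural logarithms, and the theorem *)

Lemma trunc_log_le_ln (R : realType) (n : nat) : (0 < n)%N ->
  (trunc_log 2 n)%:R * ln 2 <= ln n%:R :> R.
Proof.
move=> n_gt0; rewrite mulr_natl -lnXn ?ltr0n // ler_ln ?posrE ?exprn_gt0 ?ltr0n //.
by rewrite -natrX ler_nat trunc_logP.
Qed.

Theorem theorem2 (R : realType) :
  (forall (I : finType) (T : nat) (a b : I -> R), pap_instance T a b ->
     (exists t : R, peak T a b t) /\
     (forall t : R, peak T a b t ->
        (exists s, sorted_events (shift T t a) (shift T t b) s) /\
        (forall s, sorted_events (shift T t a) (shift T t b) s ->
           exists M : {set I * I},
             match_events [::] finset.set0 s = Some M /\ pap_optimal T a b M))) /\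
  (exists C : R,
   forall (I : finType) (T : nat) (a b : I -> R), pap_instance T a b ->
     let run := ssm_program T%:R a b (enum I) in
     (exists arcs : seq (I * I),
        value run = Some arcs /\
        ssm_outcome T a b [set ij in arcs]%SET) /\
     ((2 <= #|I|)%N ->
        (time run)%:R <= C * (#|I|%:R * ln #|I|%:R))).
Proof.
split=> [I T a b [T_gt0 _ _]|].
  split=> [|t tP]; first exact: exists_peak.
  split=> [|s sP].
    exists (sort event_le (events (shift T t a) (shift T t b))); split.
      by rewrite perm_sort.
    exact/sort_sorted/event_le_total.
  have [arcs [_ outE opt]] := ssm_correct T_gt0 tP sP.
  by exists [set ij in arcs]%SET.
(* [run_time] is applied with [K] equal to [trunc_log 2 #|I|] plus 2, at most three times that
   logarithm when there are two tasks or more; 273 is 3 times 91, and [ln 2] changes the base. *)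
exists (273 / ln 2) => I T a b [T_gt0 I_gt0 ranges] run.
have [ar br] := (fun i => (ranges i).1, fun i => (ranges i).2).
split=> [|I_gt1]; first exact: run_outcome.
have [k_gt0 lt_k] : (0 < trunc_log 2 #|I| /\ 2 * #|I| < 2 ^ (trunc_log 2 #|I|).+2)%N.
  by rewrite trunc_log_gt0 I_gt1 expnS ltn_pmul2l // trunc_log_ltn.
have time_le : (time run <= 273 * (#|I| * trunc_log 2 #|I|))%N.
  by have := run_time T_gt0 ar br I_gt0 (ltn0Sn _) lt_k; rewrite -/run; nia.
have ln2 : 0 < ln 2 :> R by rewrite ln_gt0 ?ltr1n.
rewrite (le_trans (_ : _ <= (273 * (#|I| * trunc_log 2 #|I|))%:R)) ?ler_nat //.
rewrite mulrAC ler_pdivlMr // !natrM -!mulrA ler_pM2l ?ltr0n //.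
by rewrite ler_pM2l ?ltr0n // trunc_log_le_ln.
Qed.
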